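(* Let $\mathbf{w}=0\,3\,2\,3\,0$ (a word of length $5$). Then $\mathbf{w}$ is blocking for the sand automaton $\Gamma$. Consequently $\Gamma$ has equicontinuity points, i.e. there is $\mathbf{x}\in X$ at which $(X,\Gamma)$ is equicontinuous.
   Context: Let $\widetilde{\mathbb{Z}}=\mathbb{Z}\cup\{-\infty,+\infty\}$ and $X=\widetilde{\mathbb{Z}}^{\mathbb{Z}}$. Identify $\mathbb{Z}_5$ with $\{-2,-1,0,1,2\}$ and let $\oplus$ denote addition mod $5$ with representatives in this set. For $m\in\mathbb{Z}$ and $n\in\widetilde{\mathbb{Z}}$ let the clamped gradient $\delta_m(n)\in\{-2,\dots,2\}$ be $2$ if $n>m+1$, $-2$ if $n<m-1$, and $n-m$ otherwise. The sand automaton $\Gamma:X\to X$ is defined by $\Gamma(\mathbf{x})_i=x_i$ if $x_i=\pm\infty$, and, if $x_i\in\mathbb{Z}$, $$\Gamma(\mathbf{x})_i=x_i+\bigl(\delta_{x_i}(x_{i-1})\oplus\delta_{x_i}(x_{i+1})\bigr),$$ where the outer sum is taken in $\mathbb{Z}$. For a word $\mathbf{w}$ of length $|\mathbf{w}|$ and $i\in\mathbb{Z}$, $[\mathbf{w}]_i=\{\mathbf{x}\in X:\mathbf{x}_{[i,i+|\mathbf{w}|-1]}=\mathbf{w}\}$, where $\mathbf{x}_{[m,n]}=x_mx_{m+1}\cdots x_n$. A word $\mathbf{w}$ is blocking for a sand automaton $\Phi$ if there exist $k,s\in\mathbb{N}$ with $0\le k+s\le|\mathbf{w}|$ such that whenever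 $\mathbf{x},\mathbf{y}\in[\mathbf{w}]_i$, then $(\Phi^n(\mathbf{x}))_{[i+k,\,i+|\mathbf{w}|-s]}=(\Phi^n(\mathbf{y}))_{[i+k,\,i+|\mathbf{w}|-s]}$ for all $n\in\mathbb{N}$. Topology on $X$: let $e:X\to\{0,1\}^{\mathbb{Z}^2}$ be the injection with $(e(\mathbf{x}))_{i,j}=1$ if $j\le x_i$ and $0$ if $j>x_i$. $X$ carries the topology $\mathcal{T}$ making $e$ a homeomorphism onto its (compact) image, where $\{0,1\}^{\mathbb{Z}^2}$ has the product (Cantor) topology; let $d$ be a compatible metric (by compactness the choice is immaterial). $(X,F)$ is equicontinuous at $x\in X$ if for every $\epsilon>0$ there is $\delta>0$ such that $d(F^n(x),F^n(y))<\epsilon$ for all $y$ with $d(x,y)<\delta$ and all $n>0$. *)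

(* Defs.v *)
From HB Require Import structures.
From mathcomp Require Import all_boot all_order all_algebra.
From mathcomp Require Import all_classical all_reals all_analysis.

Set Implicit Arguments.
Unset Strict Implicit.
Unset Printing Implicit Defensive.

Import Order.TTheory GRing.Theory Num.Theory.
Local Open Scope classical_set_scope.
Local Open Scope ring_scope.

Definition encode (x : int -> \bar int) : {ptws int * int -> bool} :=
  fun ij => (ij.2%:E <= x ij.1)%E.

(* Since [encode] is injective, the topology making it a homeomorphism onto its
   image is the initial topology. The topology on [bool] is discrete. *)
Definition config : Type := initial_topology encode.

HB.instance Definition _ := Choice.on config.
HB.instance Definition _ := Topological.on config.

(* The representative of [a + b] modulo 5 in {-2, -1, 0, 1, 2}. *)
Definition add5 (a b : int) : int := ((a + b + 2) %% 5)%Z - 2.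

Definition gradient (m : int) (n : \bar int) : int :=
  if ((m + 1)%:E < n)%E then 2
  else if (n < (m - 1)%:E)%E then -2
  else fine n - m.

Definition Gamma (x : config) : config := fun i =>
  if x i is m%:E
  then (m + add5 (gradient m (x (i - 1))) (gradient m (x (i + 1))))%:E
  else x i.

Definition cylinder (w : seq (\bar int)) (i : int) : set config :=
  [set x | forall j : nat, (j < size w)%N -> x (i + j%:Z) = nth 0%:E w j].

Definition blocking (Phi : config -> config) (w : seq (\bar int)) : Prop :=
  exists k s : nat, (k + s <= size w)%N /\
    forall (i : int) (x y : config), cylinder w i x -> cylinder w i y ->
    forall (n : nat) (j : int), i + k%:Z <= j <= i + (size w)%:Z - s%:Z ->
      iter n Phi x j = iter n Phi y j.

Definition is_distance (T : Type) (R : realType) (d : T -> T -> R) : Prop :=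
  [/\ forall x y, 0 <= d x y,
      forall x y, d x y = 0 <-> x = y,
      forall x y, d x y = d y x
    & forall x y z, d x z <= d x y + d y z].

Definition compatible_metric (T : topologicalType) (R : realType)
    (d : T -> T -> R) : Prop :=
  is_distance d /\
  forall (x : T) (A : set T),
    nbhs x A <-> exists2 eps : R, 0 < eps & [set y | d x y < eps] `<=` A.

Definition equicontinuous_at (T : Type) (R : realType) (d : T -> T -> R)
    (F : T -> T) (x : T) : Prop :=
  forall eps : R, 0 < eps -> exists2 delta : R, 0 < delta &
    forall y : T, d x y < delta ->
    forall n : nat, (0 < n)%N -> d (iter n F x) (iter n F y) < eps.

(* Main.v *)
Require Import Defs.
From mathcomp Require Import all_boot all_order all_algebra.
From mathcomp Require Import all_classical all_reals all_analysis.
From mathcomp Require Import zify.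

Import Order.TTheory GRing.Theory Num.Theory.
Local Open Scope classical_set_scope.
Local Open Scope ring_scope.

(** Why the theorem holds.  In 0 3 2 3 0, each 3 sees a cell at least three
    below it on the outer side and a 2 on the inner side, and -2 + -1 = 2 mod 5;
    the central 2 sees two 3s, and 1 + 1 = 2.  Hence the core 3 2 3 climbs by 2 at
    every step, as long as the outer cells stay at least three below the 3s.
    They do, because no cell ever climbs by more than 2 in one step.  So the
    core evolves independently of what lies outside the word.

    If two copies of the word share a 0, that 0 lies between two cells at
    least three above it and moves by 2 + 2 = -1 mod 5.  The periodic configuration
    (0 3 2 3)^oo therefore has an explicit orbit ([wave]), and a configuration
    that agrees with it on a stretch of cells bounded by two 0s follows this
    orbit strictly inside the stretch ([iter_Gamma_wave]).  The stretch
    0 3 2 3 0 gives the blocking property.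

    The periodic configuration is a point of equicontinuity.  Its entries are
    finite, so all nearby configurations coincide with it on a prescribed
    window, and their orbits coincide with its orbit on a slightly
    smaller window at all times ([near_window], [iter_Gamma_wave]).  It remains
    to see that agreement on one window gives closeness at all times.  This
    could be deduced from the compactness of the space, but here the orbit
    converges, to +oo on the cores and -oo on the 0s ([wave_limit]): at late
    times both orbits are close to the limit ([agree_wave_limit]), and only
    finitely many early times remain, each requiring some finite window
    ([nbhs_agree]). *)

Lemma gradient_fin (m c : int) :
  gradient m c%:E =
    if m + 1 < c then 2 else if c < m - 1 then - 2 else c - m.
Proof. by rewrite /gradient !lte_fin. Qed.

Lemma add5_le2 (a b : int) : add5 a b <= 2.
Proof. by rewrite /add5; lia. Qed.

(** The orbit of (0 3 2 3)^oo: height of cell [j] at time [n]. *)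
Definition wave (n : nat) (j : int) : int :=
  if (j %% 4)%Z == 0 then - n%:Z
  else (if (j %% 4)%Z == 2 then 2 else 3) + 2 * n%:Z.

Lemma wave_shift (n : nat) (k j : int) : wave n (4 * k + j) = wave n j.
Proof. by rewrite /wave; have -> : ((4 * k + j) %% 4)%Z = (j %% 4)%Z by lia. Qed.

(** The invariant of the evolution on the stretch of cells [i, i + 4m].  Each
    end cell has a neighbour outside the stretch, so its height cannot be
    known; the bound [2 * n] keeps it three below the adjacent core cell. *)
Definition follows_wave (i : int) (m n : nat) (y : config) : Prop :=
  forall j : int, 0 <= j <= 4 * m%:Z ->
    if (j == 0) || (j == 4 * m%:Z)
    then exists2 c : int, y (i + j) = c%:E & c <= 2 * n%:Z
    else y (i + j) = (wave n j)%:E.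

Lemma follows_wave_Gamma (i : int) (m n : nat) (y : config) :
  follows_wave i m n y -> follows_wave i m n.+1 (Gamma y).
Proof.
move=> yw j j4.
have core k : 0 <= k <= 4 * m%:Z -> (k %% 4)%Z != 0 ->
    y (i + k) = (wave n k)%:E.
  by move=> k4 k0; have := yw k k4; case: ifP => //; lia.
have trough k : 0 <= k <= 4 * m%:Z -> (k %% 4)%Z = 0 ->
    exists2 c : int, y (i + k) = c%:E & c <= 2 * n%:Z.
  move=> k4 k0; have := yw k k4; case: ifP => // _ ->.
  by exists (wave n k) => //; rewrite /wave k0 eqxx; lia.
case: ifP => j_end.
  have [||c yc c_le] := trough j => //; first by lia.
  rewrite /Gamma yc; set a := gradient _ _; set b := gradient _ _.
  by exists (c + add5 a b) => //; have := add5_le2 a b; lia.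
rewrite /Gamma; have [j0|j0] := eqVneq (j %% 4)%Z 0.
  have := yw j j4; rewrite j_end => ->.
  rewrite -!addrA !core ?gradient_fin; try lia.
  rewrite /wave /add5.
  have -> : ((j - 1) %% 4)%Z = 3 by lia.
  have -> : ((j + 1) %% 4)%Z = 1 by lia.
  by rewrite j0 /=; congr (_%:E); repeat case: ifP; lia.
rewrite core // -!addrA.
have [j2|j2] := eqVneq (j %% 4)%Z 2.
  rewrite !core ?gradient_fin; try lia.
  rewrite /wave /add5.
  have -> : ((j - 1) %% 4)%Z = 1 by lia.
  have -> : ((j + 1) %% 4)%Z = 3 by lia.
  by rewrite j2 /=; congr (_%:E); repeat case: ifP; lia.
have [j1|j1] := eqVneq (j %% 4)%Z 1.
  rewrite (core (j + 1)); try lia.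
  have [||c -> c_le] := trough (j - 1); try lia.
  rewrite !gradient_fin /wave /add5.
  have -> : ((j + 1) %% 4)%Z = 2 by lia.
  by rewrite j1 /=; congr (_%:E); repeat case: ifP; lia.
rewrite (core (j - 1)); try lia.
have [||c -> c_le] := trough (j + 1); try lia.
rewrite !gradient_fin /wave /add5.
have -> : ((j - 1) %% 4)%Z = 2 by lia.
have -> : (j %% 4)%Z = 3 by lia.
by rewrite /=; congr (_%:E); repeat case: ifP; lia.
Qed.

(** Nothing enters a stretch of the wave through its two end cells. *)
Lemma iter_Gamma_wave (i : int) (m : nat) (y : config) :
  (forall j : int, 0 <= j <= 4 * m%:Z -> y (i + j) = (wave 0 j)%:E) ->
  forall (n : nat) (j : int), 0 < j < 4 * m%:Z ->
    iter n Gamma y (i + j) = (wave n j)%:E.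
Proof.
move=> y0 n j j4.
have : follows_wave i m n (iter n Gamma y).
  elim: n => [|n] /=; last exact: follows_wave_Gamma.
  move=> k k4; rewrite y0 //; case: ifP => // k_end.
  by exists (wave 0 k) => //; rewrite /wave ifT //; lia.
by move=> /(_ j); case: ifP => [|_]; [lia | apply; lia].
Qed.

Lemma blocking_03230 :
  blocking Gamma [:: 0%:E; 3%:E; 2%:E; 3%:E; 0%:E].
Proof.
(* The margins 1 and 2 select the core 3 2 3: the interval of [blocking] is
   closed, so a right margin of 1 would still include the last cell. *)
exists 1, 2; split=> // i x y xw yw n j /= j_in.
have coreE (z : config) : cylinder [:: 0%:E; 3%:E; 2%:E; 3%:E; 0%:E] i z ->
    iter n Gamma z j = (wave n (j - i))%:E.
  move=> zw; rewrite -[j in LHS](subrKC i) (iter_Gamma_wave _ 1) => [//|k k4|];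
    last by lia.
  have [l -> l4] : exists2 l : nat, k = l%:Z & (l < 5)%N.
    by exists `|k|%N; lia.
  by rewrite (zw l l4); case: l l4 => [|[|[|[|[|]]]]].
by rewrite !coreE.
Qed.

(** Agreement of the encodings on a finite square of (cell, height) pairs.
    For a fixed first argument these sets form a basis of neighbourhoods, also
    at configurations with infinite entries. *)
Definition agree (M : nat) (x y : config) : Prop :=
  forall i j : int, `|i| <= M%:Z -> `|j| <= M%:Z ->
    encode x (i, j) = encode y (i, j).

Lemma agree_mono (M N : nat) (x y : config) :
  (M <= N)%N -> agree N x y -> agree M x y.
Proof. by move=> MN xy i j iM jM; apply: xy; lia. Qed.

(** The filter generated by the sets [agree M x] converges to [x], since it
    does so in each coordinate of the product. *)
Lemma nbhs_agree (x : config) (A : set config) :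
  nbhs x A -> exists M : nat, agree M x `<=` A.
Proof.
pose G := filter_from [set: nat] (fun M => agree M x).
have GF : Filter G.
  apply: filter_from_filter; first by exists 0%N.
  move=> M N _ _; exists (maxn M N) => // y xy.
  by split; apply: agree_mono xy; rewrite ?leq_maxl ?leq_maxr.
have encG : (encode @ G) --> encode x.
  apply/cvg_sup => -[i j] B [_ [[C oC <-] Cx] CB].
  exists (maxn `|i| `|j|)%N => // y xy; apply: CB.
  by rewrite /preimage /proj /= in Cx *; rewrite -xy //; lia.
rewrite nbhsE => -[_ [[C oC <-] Cx] CA].
have [M _ MC] := encG C (open_nbhs_nbhs (conj oC Cx)).
by exists M => y /MC; apply: CA.
Qed.

Lemma near_encode (x : config) (p : int * int) :
  \forall y \near x, encode y p = encode x p.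
Proof.
have enc : continuous (encode : config -> {ptws int * int -> bool}).
  exact: initial_continuous.
have pr := @proj_continuous _ (fun=> bool) p (encode x).
have := continuous_comp (enc x) pr => /(_ [set encode x p]); apply.
by [].
Qed.

(** A finite height [m] is recognized by two bits of the encoding, those at
    heights [m] and [m + 1]; an infinite one would require infinitely many. *)
Lemma near_fin_num (x : config) (i : int) :
  x i \is a fin_num -> \forall y \near x, y i = x i.
Proof.
case xi : (x i) => [m| |] // _.
apply: filterS (filterI (near_encode x (i, m)) (near_encode x (i, m + 1))).
move=> y []; rewrite /encode /= xi !lee_fin.
case: (y i) => [k| |].
- by rewrite !lee_fin => y0 y1; congr (_%:E); lia.
- by rewrite !leey => _ y1; lia.
- by rewrite leeNy_eq lexx.
Qed.

Lemma near_window (x : config) (K : nat) :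
  (forall i, x i \is a fin_num) ->
  \forall y \near x, forall i : int, `|i| <= K%:Z -> y i = x i.
Proof.
move=> xfin.
pose agree_at (k : 'I_(K + K).+1) : set config :=
  fun y => y (k%:Z - K%:Z) = x (k%:Z - K%:Z).
have all_agree : nbhs x (fun y => forall k, agree_at k y).
  by apply: (@filter_forall _ _ agree_at (nbhs x)) => k; exact: near_fin_num.
apply: filterS all_agree => y xy i iK.
have [k ik kK] : exists2 k : nat, i = k%:Z - K%:Z & (k < (K + K).+1)%N.
  by exists (absz (i + K%:Z)); lia.
by rewrite ik; exact: (xy (Ordinal kK)).
Qed.

Definition wave_limit : config :=
  fun j => if (j %% 4)%Z == 0 then -oo%E else +oo%E.

(** At time [n] every cell of the wave is beyond height [M] or below [-M] as soon
    as [n > M], hence indistinguishable from an infinite one in that range. *)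
Lemma agree_wave_limit (M n : nat) (y : config) : (M < n)%N ->
  (forall j : int, `|j| <= M%:Z -> y j = (wave n j)%:E) ->
  agree M wave_limit y.
Proof.
move=> Mn yw i j iM jM; rewrite /encode /= yw // /wave_limit /wave.
case: ifP => _; rewrite lee_fin.
- by transitivity false; [rewrite leeNy_eq | lia].
- by rewrite leey; case: ifP; lia.
Qed.

Lemma equicontinuous_wave (R : realType) (d : config -> config -> R) :
  compatible_metric d ->
  equicontinuous_at d Gamma (fun j => (wave 0 j)%:E).
Proof.
move=> [[_ _ dC dT] dnbhs] eps eps0.
set x : config := fun j => (wave 0 j)%:E.
have close (p : config) (e : R) : 0 < e ->
    exists M : nat, forall y, agree M p y -> d p y < e.
  by move=> e0; apply: nbhs_agree; apply/dnbhs; exists e.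
have [|L dL] := close wave_limit (eps / 2); first by rewrite divr_gt0.
(* [L] is both the window needed at the limit and the last time at which the
   orbit may still differ from the limit on this window. *)
have [K [LK dK]] : exists K : nat, (L <= K)%N /\
    forall n : nat, (n <= L)%N -> forall y, agree K (iter n Gamma x) y ->
      d (iter n Gamma x) y < eps.
  have /choice[M MP] n := close (iter n Gamma x) eps eps0.
  exists (maxn L (\max_(n < L.+1) M n)); split; first exact: leq_maxl.
  move=> n nL y xy; apply: MP; apply: agree_mono xy.
  apply: leq_trans (leq_maxr _ _).
  by rewrite -ltnS in nL; exact: (@leq_bigmax _ (fun k => M (val k)) (Ordinal nL)).
have /dnbhs[delta delta0 dU] := near_window x (4 * K.+1) (fun=> isT).
exists delta => // y /dU /= yx n _.
(* The stretch has to start at a multiple of 4 and to contain the window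
   [-K, K] in its interior: it is [-4(K+1), 4(K+1)]. *)
have waveE (z : config) :
    (forall i : int, `|i| <= (4 * K.+1)%:Z -> z i = x i) ->
    forall j : int, `|j| <= K%:Z -> iter n Gamma z j = (wave n j)%:E.
  move=> zx j jK; pose i : int := 4 * - K.+1%:Z.
  rewrite -(subrKC i j) (iter_Gamma_wave _ (2 * K.+1)) => [|k k4|]; try lia.
    by rewrite wave_shift.
  by rewrite zx /x ?wave_shift //; lia.
have [nL|Ln] := leqP n L.
  by apply: dK => // i j iK jK; rewrite /encode /= !waveE.
have near_limit (z : config) :
    (forall i : int, `|i| <= (4 * K.+1)%:Z -> z i = x i) ->
    d wave_limit (iter n Gamma z) < eps / 2.
  move=> zx; apply: dL; apply: (agree_wave_limit _ n) => // j jL.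
  by apply: waveE => //; lia.
rewrite (le_lt_trans (dT _ wave_limit _)) // [ltRHS]splitr ltrD //.
  by rewrite dC near_limit.
exact: near_limit.
Qed.

Theorem proposition4p8 (R : realType) :
  blocking Gamma [:: 0%:E; 3%:E; 2%:E; 3%:E; 0%:E] /\
  forall d : config -> config -> R, compatible_metric d ->
    exists x : config, equicontinuous_at d Gamma x.
Proof.
split; first exact: blocking_03230.
by move=> d dX; exists (fun j => (wave 0 j)%:E); exact: equicontinuous_wave.
Qed.
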